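(* Let $(A,\circ_A)$ be a Zinbiel algebra and let $r\in A\otimes A$, written as $r=a+\Lambda$ with $a\in\wedge^2A$ and $\Lambda\in S^2(A)$. Let $\alpha:A\to A\otimes A$ be defined by $\alpha(x)=\big(\mathrm{Id}\otimes(L_x+R_x)-L_x\otimes\mathrm{Id}\big)r$ for $x\in A$. Then $\alpha$ induces (via $\alpha^*:A^*\otimes A^*\to A^*$) a Zinbiel algebra structure on $A^*$ such that $(A,A^* )$ is a Zinbiel bialgebra if and only if the following conditions hold for all $x,y\in A$: (i) $\big(L_{x\circ_A y}\otimes\mathrm{Id}-\mathrm{Id}\otimes L_{x\circ_A y}-L_xL_y\otimes\mathrm{Id}+L_x\otimes L_y\big)(a)=0$; (ii) $H(x)[\![r,r]\!]=0$, where $H(x)=L_x\otimes\mathrm{Id}\otimes\mathrm{Id}-\mathrm{Id}\otimes\mathrm{Id}\otimes(L_x+R_x)$.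
   Context: All vector spaces are finite-dimensional over a field $\mathbb{K}$ of characteristic different from $2$. A Zinbiel algebra $(A,\circ_A)$ is a vector space with a bilinear product satisfying $x\circ_A(y\circ_A z)=(x\circ_A y+y\circ_A x)\circ_A z$. Write $x\ast_A y=x\circ_A y+y\circ_A x$ (a commutative associative product; the resulting algebra is $A^c$), $L_x(y)=x\circ_A y$, $R_x(y)=y\circ_A x$. Left and right multiplications of a Zinbiel algebra $(A^*,\cdot_{A^*})$ are denoted $\mathcal{L},\mathcal{R}$, and $\xi\ast_{A^*}\eta=\xi\cdot_{A^*}\eta+\eta\cdot_{A^*}\xi$. Writing $r=\sum_i a_i\otimes b_i$, $$[\![r,r]\!]=-r_{13}\circ r_{12}-r_{23}\circ r_{21}+r_{13}\ast r_{21}+r_{12}\ast r_{23}-r_{13}\ast r_{23}\in A\otimes A\otimes A,$$ where $r_{13}\circ r_{12}=\sum_{i,j}a_i\circ_A a_j\otimes b_j\otimes b_i$, $r_{23}\circ r_{21}=\sum_{i,j}b_j\otimes a_i\circ_A a_j\otimes b_i$, $r_{13}\ast r_{21}=\sum_{i,j}a_i\ast_A b_j\otimes a_j\otimes b_i$, $r_{12}\ast r_{23}=\sum_{i,j}a_i\otimes b_i\ast_A a_j\otimes b_j$, $r_{13}\ast r_{23}=\sum_{i,j}a_i\otimes a_j\otimes b_i\ast_A b_j$. Zinbiel bialgebra $(A,A^* )=(A,A^*,\alpha,\beta)$: linear maps $\alpha:A\to A\otimes A$, $\beta:A^*\to A^*\otimes A^*$ such that $\alpha^*$ is a Zinbiel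 product $\cdot_{A^*}$ on $A^*$ (so $\langle\xi\cdot_{A^*}\eta,x\rangle=\langle\xi\otimes\eta,\alpha(x)\rangle$), $\beta^*$ is a Zinbiel product on $A$ (here $\beta$ is the dual of $\circ_A$: $\langle\beta(\xi),x\otimes y\rangle=\langle\xi,x\circ_A y\rangle$), and the 1-cocycle conditions hold: $\alpha(x\ast_A y)=(L_x\otimes\mathrm{Id})\alpha(y)+(\mathrm{Id}\otimes(L_y+R_y))\alpha(x)$ for all $x,y\in A$ and $\beta(\xi\ast_{A^*}\eta)=(\mathcal{L}_\xi\otimes\mathrm{Id})\beta(\eta)+(\mathrm{Id}\otimes(\mathcal{L}_\eta+\mathcal{R}_\eta))\beta(\xi)$ for all $\xi,\eta\in A^*$. *)

(* Defs.v *)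
From HB Require Import structures.
From mathcomp Require Import all_boot all_order all_algebra.
Set Implicit Arguments.
Unset Strict Implicit.
Unset Printing Implicit Defensive.

Import GRing.Theory.
Local Open Scope ring_scope.

(* The tensor product U ⊗ V is represented by matrices of coordinates in the
   bases (e_i ⊗ e_j) attached to the library's bases of U and V; the lemmas
   tlift_is_linear, tlift_pure and tlift_pure_id below are its universal
   property, so nothing depends on the choice of bases. *)
Definition tens (K : fieldType) (U V : vectType K) : Type :=
  'M[K]_(\dim {:U}, \dim {:V}).

HB.instance Definition _ (K : fieldType) (U V : vectType K) :=
  Vector.on (tens U V).

Section Tensor.
Variable K : fieldType.
Implicit Types U V W : vectType K.

Definition pure U V (u : U) (v : V) : tens U V :=
  \matrix_(i, j) (coord (vbasis {:U}) i u * coord (vbasis {:V}) j v).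

(* The linear map on U ⊗ V induced by a bilinear map f. *)
Definition tlift U V (W : lmodType K) (f : U -> V -> W) (t : tens U V) : W :=
  \sum_i \sum_j t i j *: f (vbasis {:U})`_i (vbasis {:V})`_j.

Definition bilin U V (W : lmodType K) (f : U -> V -> W) : Prop :=
  (forall v, linear (f^~ v)) /\ (forall u, linear (f u)).

End Tensor.

Notation "u *t v" := (pure u v) (at level 40, left associativity) : ring_scope.

Section TensorOps.
Variable K : fieldType.

Definition tmap (U V U' V' : vectType K) (f : U -> U') (g : V -> V') :
    tens U V -> tens U' V' :=
  tlift (fun u v => f u *t g v).

Definition flip (U V : vectType K) : tens U V -> tens V U :=
  tlift (fun u v => v *t u).

(* wedge^2 A and S^2(A), as spaces of tensors (char K <> 2). *)
Definition skew_tens (A : vectType K) (t : tens A A) : Prop := flip t = - t.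
Definition symm_tens (A : vectType K) (t : tens A A) : Prop := flip t = t.

Definition dual (A : vectType K) : vectType K := 'Hom(A, K^o).

(* <xi (x) eta, t> for t in A (x) A *)
Definition tpair (A : vectType K) (xi eta : dual A) (t : tens A A) : K :=
  tlift (fun x y => (xi x * eta y : K^o)) t.

End TensorOps.

Section Zinbiel.
Variables (K : fieldType) (A : vectType K) (mul : A -> A -> A).

Definition is_zinbiel : Prop :=
  bilin mul /\
  forall x y z, mul x (mul y z) = mul (mul x y + mul y x) z.

Definition cprod (x y : A) : A := mul x y + mul y x.
Definition lmult (x : A) : A -> A := fun y => mul x y.
Definition rmult (x : A) : A -> A := fun y => mul y x.

Definition is_cocycle (alpha : A -> tens A A) : Prop :=
  forall x y, alpha (cprod x y)
    = tmap (lmult x) id (alpha y) + tmap id (lmult y \+ rmult y) (alpha x).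

(* The two arguments of the outer tlift are (a_i, b_i), those of the inner
   one are (a_j, b_j). *)
Definition tsum2 (W : lmodType K) (r : tens A A)
    (f : A -> A -> A -> A -> W) : W :=
  tlift (fun ai bi => tlift (fun aj bj => f ai bi aj bj) r) r.

Definition zbracket (r : tens A A) : tens (tens A A) A :=
  - tsum2 r (fun ai bi aj bj => mul ai aj *t bj *t bi)
  - tsum2 r (fun ai bi aj bj => bj *t mul ai aj *t bi)
  + tsum2 r (fun ai bi aj bj => cprod ai bj *t aj *t bi)
  + tsum2 r (fun ai bi aj bj => ai *t cprod bi aj *t bj)
  - tsum2 r (fun ai bi aj bj => ai *t aj *t cprod bi bj).

(* The dual map beta : A^* -> A^* (x) A^* of the product, written in the dual
   basis; see dual_coprodP. *)
Definition dual_coprod (xi : dual A) : tens (dual A) (dual A) :=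
  \sum_(i < \dim {:A}) \sum_(j < \dim {:A}) xi (mul (vbasis {:A})`_i (vbasis {:A})`_j) *:
     ((linfun (coord (vbasis {:A}) i : A -> K^o) : dual A)
       *t (linfun (coord (vbasis {:A}) j : A -> K^o) : dual A)).

(* alpha^* as a product on A^*; see dual_prodP. *)
Definition dual_prod (alpha : A -> tens A A) (xi eta : dual A) : dual A :=
  linfun (fun x => tpair xi eta (alpha x) : K^o).

End Zinbiel.

Record is_zinbiel_bialgebra (K : fieldType) (A : vectType K)
    (mul : A -> A -> A) (alpha : A -> tens A A) : Prop := {
  zbialg_alpha_linear : linear alpha;
  zbialg_mul : is_zinbiel mul;
  zbialg_dual_mul : is_zinbiel (dual_prod alpha);
  zbialg_cocycle : is_cocycle mul alpha;
  zbialg_dual_cocycle : is_cocycle (dual_prod alpha) (dual_coprod mul)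
}.

Definition coboundary (K : fieldType) (A : vectType K) (mul : A -> A -> A)
    (r : tens A A) (x : A) : tens A A :=
  tmap id (lmult mul x \+ rmult mul x) r - tmap (lmult mul x) id r.

Section TensorTheory.
Variable K : fieldType.
Implicit Types U V : vectType K.

Lemma coord_vbasisT U (u : U) :
  u = \sum_i coord (vbasis {:U}) i u *: (vbasis {:U})`_i.
Proof. exact: coord_vbasis (memvf u). Qed.

Lemma coord_vbasis_nth U (i j : 'I_(\dim {:U})) :
  coord (vbasis {:U}) i (vbasis {:U})`_j = (i == j)%:R.
Proof. by rewrite coord_free ?(basis_free (vbasisP _)) // eq_sym. Qed.

Lemma pure_bilin U V : bilin (@pure K U V).
Proof.
split=> w a x y; apply/matrixP=> i j; rewrite !mxE linearP /=.
  by rewrite mulrDl -mulrA.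
by rewrite mulrDr mulrCA.
Qed.

Lemma tlift_is_linear U V (W : lmodType K) (f : U -> V -> W) :
  linear (tlift f).
Proof.
move=> a s t; rewrite /tlift scaler_sumr -big_split; apply: eq_bigr => i _.
rewrite scaler_sumr -big_split; apply: eq_bigr => j _.
by rewrite !mxE scalerDl scalerA.
Qed.

Lemma tlift_pure U V (W : lmodType K) (f : U -> V -> W) :
  bilin f -> forall u v, tlift f (u *t v) = f u v.
Proof.
case=> fl fr u v.
have sl I (s : seq I) (F : I -> K) (G : I -> U) w :
    f (\sum_(i <- s) F i *: G i) w = \sum_(i <- s) F i *: f (G i) w.
  elim: s => [|i s IH]; last by rewrite !big_cons fl IH.
  by have := fl w (-1) 0 0; rewrite !big_nil !scaleN1r oppr0 addr0 addNr.
have sr I (s : seq I) (F : I -> K) (G : I -> V) w :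
    f w (\sum_(i <- s) F i *: G i) = \sum_(i <- s) F i *: f w (G i).
  elim: s => [|i s IH]; last by rewrite !big_cons fr IH.
  by have := fr w (-1) 0 0; rewrite !big_nil !scaleN1r oppr0 addr0 addNr.
rewrite {2}(coord_vbasisT u) sl; apply: eq_bigr => i _.
rewrite {2}(coord_vbasisT v) sr scaler_sumr; apply: eq_bigr => j _.
by rewrite mxE scalerA.
Qed.

Lemma tlift_comp U V (W W' : lmodType K) (f : U -> V -> W) (g : W -> W') t :
  linear g -> g (tlift f t) = tlift (fun u v => g (f u v)) t.
Proof.
move=> gl; pose G := HB.pack g (GRing.isLinear.Build _ _ _ _ _ gl)
  : {linear W -> W'}.
rewrite -[g _]/(G _) /tlift linear_sum; apply: eq_bigr => i _.
by rewrite linear_sum; apply: eq_bigr => j _; rewrite linearZ.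
Qed.

Lemma tlift_pure_id U V (t : tens U V) : tlift (@pure K U V) t = t.
Proof.
apply/matrixP=> k l.
have gl : linear (fun X : tens U V => X k l : K^o).
  by move=> c X Y; rewrite !mxE.
rewrite (tlift_comp _ t gl) /tlift (bigD1 k) //= [X in _ + X]big1 ?addr0; last first.
  move=> i /negPf ik; rewrite big1 // => j _.
  by rewrite mxE coord_vbasis_nth eq_sym ik mul0r scaler0.
rewrite (bigD1 l) //= [X in _ + X]big1 ?addr0; last first.
  by move=> j /negPf jl;
     rewrite mxE !coord_vbasis_nth (eq_sym l) jl mulr0 scaler0.
by rewrite mxE !coord_vbasis_nth !eqxx mulr1 -[LHS]/(_ * _) mulr1.
Qed.

Lemma tlift_sum U V (W : lmodType K) (f : U -> V -> W) (I : Type) (s : seq I)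
    (a : I -> U) (b : I -> V) : bilin f ->
  tlift f (\sum_(i <- s) a i *t b i) = \sum_(i <- s) f (a i) (b i).
Proof.
move=> fB; elim: s => [|i s IH].
  rewrite !big_nil; have := tlift_is_linear f (-1) 0 0.
  by rewrite !scaleN1r oppr0 addr0 addNr.
rewrite !big_cons -IH -(tlift_pure fB).
by have := tlift_is_linear f 1 (a i *t b i) (\sum_(j <- s) a j *t b j);
  rewrite !scale1r.
Qed.

Lemma tpair_pure (A : vectType K) (xi eta : dual A) (x y : A) :
  tpair xi eta (x *t y) = xi x * eta y.
Proof.
rewrite /tpair tlift_pure //; split=> z a u v /=.
  by rewrite linearP mulrDl /= -scalerAl.
by rewrite linearP mulrDr /= -scalerAr.
Qed.

Lemma dual_prodP (A : vectType K) (alpha : A -> tens A A) (xi eta : dual A) x :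
  linear alpha -> dual_prod alpha xi eta x = tpair xi eta (alpha x).
Proof.
move=> al.
have fl : linear (fun x => tpair xi eta (alpha x) : K^o).
  by move=> a u v; rewrite al /tpair tlift_is_linear.
pose F := HB.pack (fun x => tpair xi eta (alpha x) : K^o)
  (GRing.isLinear.Build _ _ _ _ _ fl) : {linear A -> K^o}.
exact: (lfunE F x).
Qed.

Lemma dual_coprodP (A : vectType K) (mul : A -> A -> A) (xi : dual A) x y :
  bilin mul ->
  tlift (fun xi1 xi2 : dual A => xi1 x * xi2 y : K^o) (dual_coprod mul xi)
    = xi (mul x y).
Proof.
move=> mB.
have eB : bilin (fun xi1 xi2 : dual A => xi1 x * xi2 y : K^o).
  split=> z a u v /=; rewrite add_lfunE scale_lfunE.
    by rewrite mulrDl -scalerAl.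
  by rewrite mulrDr -scalerAr.
have mB' : bilin (fun u v => xi (mul u v)).
  by split=> w a u v; rewrite ?(mB.1 w) ?(mB.2 w) linearP.
have tl := tlift_is_linear (fun xi1 xi2 : dual A => xi1 x * xi2 y : K^o).
pose F := HB.pack (tlift (fun xi1 xi2 : dual A => xi1 x * xi2 y : K^o))
  (GRing.isLinear.Build _ _ _ _ _ tl) : {linear tens (dual A) (dual A) -> K^o}.
rewrite -[tlift _ _]/(F _) /dual_coprod linear_sum -(tlift_pure mB' x y).
apply: eq_bigr => i _; rewrite linear_sum; apply: eq_bigr => j _.
rewrite linearZ /= (tlift_pure eB) !lfunE /= !mxE.
by rewrite [LHS]mulrC.
Qed.

Lemma tsum2E (A : vectType K) (W : lmodType K) (f : A -> A -> A -> A -> W)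
    (m : nat) (a b : 'I_m -> A) :
  (forall u v, bilin (f u v)) -> (forall u v, bilin (fun s t => f s t u v)) ->
  tsum2 (\sum_i a i *t b i) f = \sum_i \sum_j f (a i) (b i) (a j) (b j).
Proof.
move=> fi fo; rewrite /tsum2 tlift_sum.
  by apply: eq_bigr => i _; rewrite tlift_sum.
split=> w c u v; rewrite /tlift scaler_sumr -big_split; apply: eq_bigr => i _;
  rewrite scaler_sumr -big_split; apply: eq_bigr => j _ /=.
  by rewrite ((fo _ _).1 w) scalerDr !scalerA mulrC.
by rewrite ((fo _ _).2 w) scalerDr !scalerA mulrC.
Qed.

Lemma zbracketE (A : vectType K) (mul : A -> A -> A) (m : nat)
    (a b : 'I_m -> A) : bilin mul ->
  zbracket mul (\sum_i a i *t b i)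
  = - (\sum_i \sum_j mul (a i) (a j) *t b j *t b i)
    - (\sum_i \sum_j b j *t mul (a i) (a j) *t b i)
    + (\sum_i \sum_j cprod mul (a i) (b j) *t a j *t b i)
    + (\sum_i \sum_j a i *t cprod mul (b i) (a j) *t b j)
    - (\sum_i \sum_j a i *t a j *t cprod mul (b i) (b j)).
Proof.
move=> [ml mr].
have cl v : linear (fun u => cprod mul u v).
  by move=> c s t; rewrite /cprod ml mr scalerDr addrACA.
have cr u : linear (cprod mul u).
  by move=> c s t; rewrite /cprod ml mr scalerDr addrACA.
have pl (U V : vectType K) (v : V) := (pure_bilin U V).1 v.
have pr (U V : vectType K) (u : U) := (pure_bilin U V).2 u.
by rewrite /zbracket !tsum2E //; move=> u v; split=> w c s t;
  rewrite ?ml ?mr ?cl ?cr ?pr ?pl ?pr ?pl.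
Qed.

End TensorTheory.

(* Main.v *)
(* Write Q(x,y) for the operator of condition (i) and r = sum_i a_i (x) b_i.  The
   1-cocycle condition on alpha holds for every r.  Paired with x (x) y, the defect of
   the 1-cocycle condition on beta is -Q(x,y)(r - flip r) = -2 Q(x,y)(a): the
   contributions of the symmetric part cancel.  The defect of the Zinbiel identity on
   A^*, evaluated at x, is H(x)[[r,r]] - 2 sum_i Q(x,a_i)(a) (x) b_i.  Hence (i) is
   equivalent to the cocycle condition on beta and, given (i), (ii) is equivalent to
   the Zinbiel identity.  All these tensor identities are checked by pairing with
   functionals. *)
From HB Require Import structures.
Require Import Defs.
From mathcomp Require Import all_boot all_order all_algebra.
From mathcomp Require Import ring.
Import GRing.Theory.
Local Open Scope ring_scope.

(** * Linear maps whose linearity is a hypothesis *)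

Section PropLinear.
Context {K : fieldType} {U W : lmodType K} {F : U -> W} (Fl : linear F).
Let G := HB.pack F (GRing.isLinear.Build _ _ _ _ _ Fl) : {linear U -> W}.

Lemma lin0 : F 0 = 0. Proof. exact: (linear0 G). Qed.
Lemma linD u v : F (u + v) = F u + F v. Proof. exact: (linearD G). Qed.
Lemma linB u v : F (u - v) = F u - F v. Proof. exact: (linearB G). Qed.
Lemma linN u : F (- u) = - F u. Proof. exact: (linearN G). Qed.
Lemma linZ c u : F (c *: u) = c *: F u. Proof. exact: (linearZ_LR G). Qed.
Lemma linS I (s : seq I) (a : I -> U) :
  F (\sum_(i <- s) a i) = \sum_(i <- s) F (a i).
Proof. exact: (linear_sum G). Qed.

End PropLinear.

(** Exchanging [i] and [j] preserves a double sum, so twice the sum is the sum of the symmetrized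
    summands, and 2 can be cancelled. This serves identities quadratic in [r], whose two copies may
    carry their indices in either order. *)
Lemma eq_sum2_swap {K : fieldType} {n : nat} (F G : 'I_n -> 'I_n -> K) :
  2%:R != 0 :> K ->
  (forall i j, F i j + F j i = G i j + G j i) ->
  \sum_i \sum_j F i j = \sum_i \sum_j G i j.
Proof.
have dbl (E : 'I_n -> 'I_n -> K) :
    2%:R * (\sum_i \sum_j E i j) = \sum_i \sum_j (E i j + E j i).
  rewrite mulr_natl mulr2n [in X in _ + X]exchange_big -big_split.
  by apply: eq_bigr => i _; rewrite -big_split.
move=> two_neq0 FG; apply: (mulfI two_neq0); rewrite !dbl.
by apply: eq_bigr => i _; apply: eq_bigr => j _.
Qed.

(** * Testing tensors against functionals *)

Section Evaluation.
Context {K : fieldType}.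
Implicit Types U V : vectType K.

(** The arguments are bare functions rather than elements of [dual], so that composites with
    multiplications and the nested form [tev (tev f g) h] on triple tensors fit without
    conversion. *)
Definition tev {U V} (f : U -> K^o) (g : V -> K^o) (t : tens U V) : K^o :=
  tlift (fun u v => f u * g v : K^o) t.

Lemma bilin_evM {U V} (f : U -> K^o) (g : V -> K^o) :
  linear f -> linear g -> bilin (fun u v => f u * g v : K^o).
Proof.
move=> fl gl; split=> w c u v /=.
  by rewrite fl mulrDl -scalerAl.
by rewrite gl mulrDr -scalerAr.
Qed.

Lemma tev_linear {U V} (f : U -> K^o) (g : V -> K^o) : linear (tev f g).
Proof. exact: tlift_is_linear. Qed.

Lemma eq_tlift {U V} {W : lmodType K} (F G : U -> V -> W) (t : tens U V) :
  (forall u v, F u v = G u v) -> tlift F t = tlift G t.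
Proof. by move=> FG; apply: eq_bigr => i _; apply: eq_bigr => j _; rewrite FG. Qed.

Lemma tev_pure {U V} {f : U -> K^o} {g : V -> K^o} u v :
  linear f -> linear g -> tev f g (u *t v) = f u * g v.
Proof. by move=> fl gl; rewrite /tev tlift_pure //; apply: bilin_evM. Qed.

Lemma tev_sum {U V} {f : U -> K^o} {g : V -> K^o} {n} (a : 'I_n -> U) b :
  linear f -> linear g ->
  tev f g (\sum_i a i *t b i) = \sum_i f (a i) * g (b i).
Proof. by move=> fl gl; rewrite /tev tlift_sum //; apply: bilin_evM. Qed.

Lemma tev_tmap {U V U' V' : vectType K} {f : U' -> K^o} {g : V' -> K^o}
    (h : U -> U') (k : V -> V') t :
  linear f -> linear g -> tev f g (tmap h k t) = tev (f \o h) (g \o k) t.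
Proof.
move=> fl gl; rewrite /tev /tmap (tlift_comp _ _ (tlift_is_linear _)).
by apply: eq_tlift => u v; rewrite tlift_pure //; apply: bilin_evM.
Qed.

Lemma tev_flip {U V} {f : V -> K^o} {g : U -> K^o} (t : tens U V) :
  linear f -> linear g -> tev f g (flip t) = tev g f t.
Proof.
move=> fl gl; rewrite /tev /flip (tlift_comp _ _ (tlift_is_linear _)).
apply: eq_tlift => u v; rewrite tlift_pure; last exact: bilin_evM.
exact: mulrC.
Qed.

Lemma tens_sum_pure {U V} (t : tens U V) :
  exists n (a : 'I_n -> U) (b : 'I_n -> V), t = \sum_i a i *t b i.
Proof.
exists (\dim {:U}), (fun i => (vbasis {:U})`_i).
exists (fun i => \sum_j t i j *: (vbasis {:V})`_j).
rewrite -[LHS]tlift_pure_id; apply: eq_bigr => i _.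
have pl := (pure_bilin U V).2 (vbasis {:U})`_i.
by rewrite (linS pl); apply: eq_bigr => j _; rewrite (linZ pl).
Qed.

Lemma coord_linear {U} k : linear (coord (vbasis {:U}) k : U -> K^o).
Proof. by move=> c u v; rewrite linearP. Qed.

Lemma tev_coord {U V} (t : tens U V) i j :
  tev (coord (vbasis {:U}) i) (coord (vbasis {:V}) j) t = t i j.
Proof.
have gl : linear (fun X : tens U V => X i j : K^o) by move=> c X Y; rewrite !mxE.
rewrite -[in RHS](tlift_pure_id t) (tlift_comp _ t gl).
by apply: eq_tlift => u v; rewrite mxE.
Qed.

(** The coordinate functionals already recover every matrix entry of [t]. *)
Lemma tev_nondeg {U V} (t : tens U V) :
  (forall f g, linear f -> linear g -> tev f g t = 0) -> t = 0.
Proof.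
move=> t0; apply/matrixP => i j; rewrite mxE -tev_coord.
by apply: t0; apply: coord_linear.
Qed.

Lemma tens_ext {U V} (s t : tens U V) :
  (forall f g, linear f -> linear g -> tev f g s = tev f g t) -> s = t.
Proof.
move=> st; apply/eqP; rewrite -subr_eq0; apply/eqP; apply: tev_nondeg => f g fl gl.
by rewrite (linB (tev_linear _ _)) st // subrr.
Qed.

Lemma linear_linfun {U} (f : U -> K^o) : linear f -> exists xi : dual U, xi =1 f.
Proof.
move=> fl; pose F := HB.pack f (GRing.isLinear.Build _ _ _ _ _ fl) : {linear U -> K^o}.
by exists (linfun F) => x; rewrite lfunE.
Qed.

Lemma dual_linear {U} (xi : dual U) : linear (xi : U -> K^o).
Proof. by move=> c u v; rewrite linearP. Qed.

Lemma eq_tev {U V} {f f' : U -> K^o} {g g' : V -> K^o} t :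
  f =1 f' -> g =1 g' -> tev f g t = tev f' g' t.
Proof. by move=> ff gg; apply: eq_tlift => u v; rewrite ff gg. Qed.

Lemma tev_nondeg_dual {U} (t : tens U U) :
  (forall xi eta : dual U, tev xi eta t = 0) -> t = 0.
Proof.
move=> t0; apply: tev_nondeg => f g /linear_linfun[xi xiE] /linear_linfun[eta etaE].
by rewrite -(eq_tev t xiE etaE); apply: t0.
Qed.

(** A functional on [tens U U] need not be of the form [tev xi eta], so [tev_nondeg] does not apply
    at once. Contracting the third leg with [g] gives a tensor in two legs, which vanishes by the
    two-leg case; [f] is then applied to it. *)
Lemma tev3_nondeg_dual {U} (t : tens (tens U U) U) :
  (forall xi eta zeta : dual U, tev (tev xi eta) zeta t = 0) -> t = 0.
Proof.
move=> t0; apply: tev_nondeg => f g fl gl.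
have sl : bilin (fun s w => g w *: s : tens U U).
  split=> w c u v; rewrite ?gl; first by rewrite scalerDr !scalerA mulrC.
  by rewrite scalerDl scalerA.
have s0 : tlift (fun s w => g w *: s) t = 0.
  apply: tev_nondeg_dual => xi eta; have [zeta zetaE] := linear_linfun _ gl.
  rewrite (tlift_comp _ t (tev_linear xi eta)).
  rewrite -[RHS](t0 xi eta zeta); apply: eq_tlift => s w.
  by rewrite (linZ (tev_linear xi eta)) -zetaE mulrC.
rewrite -(lin0 fl) -s0 (tlift_comp _ t fl); apply: eq_tlift => s w.
by rewrite (linZ fl) mulrC.
Qed.

(** Reflexivity in finite dimension: the representing vector has as coordinates the values of [phi]
    on the dual basis [e]. *)
Lemma dual_eval {U} (phi : dual U -> K^o) :
  linear phi -> exists x, forall xi, phi xi = xi x.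
Proof.
move=> phil; pose e k := linfun (coord (vbasis {:U}) k : U -> K^o) : dual U.
exists (\sum_(k < \dim {:U}) phi (e k) *: (vbasis {:U})`_k) => xi.
have {1}-> : xi = \sum_(k < \dim {:U}) xi (vbasis {:U})`_k *: e k.
  apply/lfunP => x; rewrite {1}(coord_vbasisT x) linear_sum sum_lfunE.
  apply: eq_bigr => k _; rewrite scale_lfunE lfunE linearZ /=.
  exact: mulrC.
rewrite (linS phil) linear_sum; apply: eq_bigr => k _.
rewrite (linZ phil) linearZ; exact: mulrC.
Qed.

Lemma tev_nondeg_eval {U} (t : tens (dual U) (dual U)) :
  (forall x y : U, tev (fun xi : dual U => xi x) (fun xi : dual U => xi y) t = 0) ->
  t = 0.
Proof.
move=> t0; apply: tev_nondeg => f g /dual_eval[x xE] /dual_eval[y yE].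
by rewrite (eq_tev t xE yE); apply: t0.
Qed.

(** Antisymmetrizing cancels [Lam] and doubles [a]; this is how statements about [a] become
    statements about [r]. *)
Lemma tev_flipE {U} {f g : U -> K^o} {r a Lam : tens U U} :
  r = a + Lam -> flip a = - a -> flip Lam = Lam -> linear f -> linear g ->
  tev f g r - tev g f r = tev f g a *+ 2.
Proof.
move=> -> aN LamE fl gl; rewrite !(linD (tev_linear _ _)).
rewrite -(tev_flip a fl gl) -(tev_flip Lam fl gl) aN LamE (linN (tev_linear _ _)).
by rewrite opprD opprK addrACA subrr addr0 mulr2n.
Qed.

End Evaluation.

(* The operator of condition (i), applied to [t]. *)
Definition lmult_defect {K : fieldType} {A : vectType K} (mul : A -> A -> A)
    (x y : A) (t : tens A A) : tens A A :=
  tmap (lmult mul (mul x y)) id t - tmap id (lmult mul (mul x y)) t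
  - tmap (lmult mul x \o lmult mul y) id t + tmap (lmult mul x) (lmult mul y) t.

(** * Coboundaries and the defects of the bialgebra axioms *)

Section Coboundary.
Context {K : fieldType} {A : vectType K} {mul : A -> A -> A}.
Hypothesis zinA : is_zinbiel mul.
Implicit Types (x y z : A) (xi eta zeta : dual A).

Let mulLl y : linear (fun x => mul x y) := zinA.1.1 y.
Let mulLr x : linear (mul x) := zinA.1.2 x.
Let mulDl x y z : mul (x + y) z = mul x z + mul y z.
Proof. exact: (linD (mulLl z)). Qed.
Let mulDr x y z : mul x (y + z) = mul x y + mul x z.
Proof. exact: (linD (mulLr x)). Qed.
(* Orienting the Zinbiel identity this way rewrites every monomial into left-bracketed
   ones, which form a basis of the free Zinbiel algebra; [ring] can then conclude. *)
Let mulA x y z : mul x (mul y z) = mul (mul x y) z + mul (mul y x) z.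
Proof. by rewrite zinA.2 mulDl. Qed.
Let mulE := (mulDl, mulDr, mulA).

Lemma lmult_linear x : linear (lmult mul x). Proof. exact: mulLr. Qed.
Lemma lrmult_linear x : linear (lmult mul x \+ rmult mul x).
Proof.
by move=> c u v; rewrite /= /lmult /rmult mulLl mulLr scalerDr addrACA.
Qed.

Lemma linear_comp_mul {f : A -> K^o} x : linear f -> linear (f \o lmult mul x).
Proof. by move=> fl c u v; rewrite /= lmult_linear fl. Qed.
Lemma linear_comp_lrmul {f : A -> K^o} x : linear f ->
  linear (f \o (lmult mul x \+ rmult mul x)).
Proof. by move=> fl c u v; rewrite [in LHS]/comp lrmult_linear fl. Qed.

Context {n : nat} {a b : 'I_n -> A}.
Let r : tens A A := \sum_i a i *t b i.
Let alpha : A -> tens A A := coboundary mul r.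

Lemma tev_coboundary {f g : A -> K^o} x : linear f -> linear g ->
  tev f g (alpha x) =
  \sum_i (f (a i) * (g (mul x (b i)) + g (mul (b i) x)) - f (mul x (a i)) * g (b i)).
Proof.
move=> fl gl; rewrite /alpha /coboundary (linB (tev_linear _ _)) !tev_tmap //.
rewrite !tev_sum //; try exact: linear_comp_mul; try exact: linear_comp_lrmul.
by rewrite -sumrB; apply: eq_bigr => i _ /=; rewrite (linD gl).
Qed.

Lemma coboundary_linear : linear alpha.
Proof.
move=> c x y; apply: tens_ext => f g fl gl.
rewrite tev_linear !tev_coboundary // scaler_sumr -big_split; apply: eq_bigr => i _.
rewrite mulLl mulLr mulLl !fl !gl -![_ *: _]/(_ * _) /=.
ring.
Qed.

Lemma dual_prod_coboundary xi eta x :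
  dual_prod alpha xi eta x =
  \sum_i (xi (a i) * (eta (mul x (b i)) + eta (mul (b i) x))
           - xi (mul x (a i)) * eta (b i)).
Proof.
rewrite dual_prodP; last exact: coboundary_linear.
by rewrite -[LHS]/(tev xi eta _) tev_coboundary //; apply: dual_linear.
Qed.

Lemma bilin_dual_prod_coboundary : bilin (dual_prod alpha).
Proof.
split=> zeta c xi eta; apply/lfunP => x; rewrite add_lfunE scale_lfunE;
  rewrite !dual_prod_coboundary scaler_sumr -big_split; apply: eq_bigr => i _;
  rewrite !add_lfunE !scale_lfunE -![_ *: _]/(_ * _) /=; ring.
Qed.

(** The mixed terms, with [x] acting on the first leg and [y] on the second, cancel. The rest is
    $L_{x\ast y}=L_xL_y$ on the first leg and $(x\ast y)\ast b=y\ast(x\ast b)$ on the second. *)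
Lemma coboundary_cocycle : is_cocycle mul alpha.
Proof.
move=> x y; apply: tens_ext => f g fl gl.
rewrite [in RHS](linD (tev_linear _ _)) !tev_tmap //.
have fxl := linear_comp_mul x fl; have gyl := linear_comp_lrmul y gl.
rewrite (tev_coboundary _ fl gl) (tev_coboundary _ fxl gl) (tev_coboundary _ fl gyl).
rewrite -big_split; apply: eq_bigr => i _.
rewrite /cprod /lmult /rmult /= !mulE.
rewrite !(linD fl) !(linD gl); ring.
Qed.

Context {s Lam : tens A A}.
Hypotheses (rE : r = s + Lam) (skew_s : skew_tens s) (symm_Lam : symm_tens Lam).

(** Only [r] comes with a decomposition into pure tensors, so [s] is reached through
    $2s=r-\mathrm{flip}(r)$, applied to each of the four terms of the operator. *)
Lemma tev_lmult_defect_skew {f g : A -> K^o} x y : linear f -> linear g ->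
  let q u v := f (mul (mul x y) u) * g v - f u * g (mul (mul x y) v)
    - f (mul x (mul y u)) * g v + f (mul x u) * g (mul y v) in
  tev f g (lmult_defect mul x y s) *+ 2 = \sum_i (q (a i) (b i) - q (b i) (a i)).
Proof.
move=> fl gl q; rewrite /lmult_defect !(linD (tev_linear _ _), linN (tev_linear _ _)).
rewrite !tev_tmap // !mulrnDl !mulNrn.
have fm z := linear_comp_mul z fl; have gm z := linear_comp_mul z gl.
have fmm : linear (f \o (lmult mul x \o lmult mul y)).
  by move=> c u v; rewrite /= !lmult_linear fl.
rewrite -(tev_flipE rE skew_s symm_Lam (fm _) gl).
rewrite -(tev_flipE rE skew_s symm_Lam fl (gm _)).
rewrite -(tev_flipE rE skew_s symm_Lam fmm gl).
rewrite -(tev_flipE rE skew_s symm_Lam (fm x) (gm y)).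
rewrite !tev_sum // -!sumrB -big_split; apply: eq_bigr => i _.
rewrite /q /lmult /=; ring.
Qed.

(** Once the dual coproducts are evaluated, both sides are linear in [r] and agree summand by
    summand, by the Zinbiel identity of [A]. *)
Lemma dual_cocycle_defect xi eta x y :
  tev (fun phi : dual A => phi x) (fun phi : dual A => phi y)
    (dual_coprod mul (cprod (dual_prod alpha) xi eta)
     - (tmap (lmult (dual_prod alpha) xi) id (dual_coprod mul eta)
        + tmap id (lmult (dual_prod alpha) eta \+ rmult (dual_prod alpha) eta)
            (dual_coprod mul xi)))
  = - (tev xi eta (lmult_defect mul x y s) *+ 2).
Proof.
have evl (z : A) : linear (fun phi : dual A => phi z : K^o).
  by move=> c u v; rewrite add_lfunE scale_lfunE.
rewrite (linB (tev_linear _ _)) (linD (tev_linear _ _)) !tev_tmap //.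
(* [x'] and [y'] are the images of x and y under the transposes of the left
   multiplication by xi and of the commutative multiplication by eta. *)
pose x' := \sum_i (xi (a i) *: (mul x (b i) + mul (b i) x) - xi (mul x (a i)) *: b i).
pose y' := \sum_i (eta (a i) *: (mul y (b i) + mul (b i) y) - eta (mul y (a i)) *: b i
   + (eta (mul y (b i) + mul (b i) y) *: a i - eta (b i) *: mul y (a i))).
have coprodE (phi : dual A) u v :
    tev (fun psi : dual A => psi u) (fun psi : dual A => psi v)
      (dual_coprod mul phi) = phi (mul u v).
  by rewrite -(dual_coprodP phi u v zinA.1).
have lE psi : (lmult (dual_prod alpha) xi psi) x = psi x'.
  rewrite /lmult dual_prod_coboundary /x' linear_sum.
  by apply: eq_bigr => i _; rewrite linearB !linearZ !linearD.
have rE' psi : ((lmult (dual_prod alpha) eta \+ rmult (dual_prod alpha) eta) psi) y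
    = psi y'.
  rewrite /= /lmult /rmult add_lfunE !dual_prod_coboundary /y' linear_sum.
  rewrite -big_split; apply: eq_bigr => i _.
  rewrite !(linearB, linearZ, linearD) /= -![_ *: _]/(_ * _); ring.
rewrite (eq_tev (dual_coprod mul eta) lE (frefl _)).
rewrite (eq_tev (dual_coprod mul xi) (frefl _) rE').
rewrite !coprodE.
rewrite /x' /y' (linS (mulLl y)) (linS (mulLr x)) !linear_sum.
rewrite tev_lmult_defect_skew; try exact: dual_linear.
rewrite /cprod add_lfunE !dual_prod_coboundary -!big_split -!sumrN -!big_split.
apply: eq_bigr => i _ /=.
rewrite !(linB (mulLl _), linB (mulLr _), linD (mulLl _), linD (mulLr _),
  linZ (mulLl _), linZ (mulLr _)).
rewrite !(linearB, linearZ, linearD) /= -![_ *: _]/(_ * _) !mulE.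
rewrite !(linearD xi) !(linearD eta).
ring.
Qed.

Lemma tev_zbracket {f g h : A -> K^o} :
  linear f -> linear g -> linear h ->
  tev (tev f g) h (zbracket mul r) =
  \sum_i \sum_j (- (f (mul (a i) (a j)) * g (b j) * h (b i))
    - f (b j) * g (mul (a i) (a j)) * h (b i)
    + f (cprod mul (a i) (b j)) * g (a j) * h (b i)
    + f (a i) * g (cprod mul (b i) (a j)) * h (b j)
    - f (a i) * g (a j) * h (cprod mul (b i) (b j))).
Proof.
move=> fl gl hl; have fgl := tev_linear f g; have l := tev_linear (tev f g) h.
have p u v w : tev (tev f g) h (u *t v *t w) = f u * g v * h w.
  by rewrite !tev_pure.
rewrite zbracketE; last exact: zinA.1.
rewrite (linB l) !(linD l) !(linN l) !(linS l).
rewrite -!sumrN -!big_split; apply: eq_bigr => i _.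
rewrite !(linS l) -!sumrN -!big_split; apply: eq_bigr => j _.
by rewrite !p.
Qed.

Lemma tev_H {f g h : A -> K^o} x (t : tens (tens A A) A) :
  linear f -> linear g -> linear h ->
  tev (tev f g) h (tmap (tmap (lmult mul x) id) id t
                   - tmap id (lmult mul x \+ rmult mul x) t)
  = tev (tev (f \o lmult mul x) g) h t
    - tev (tev f g) (h \o (lmult mul x \+ rmult mul x)) t.
Proof.
move=> fl gl hl; have fgl := tev_linear f g.
rewrite (linB (tev_linear _ _)) !tev_tmap //; congr (_ - _).
by apply: eq_tev => // u; rewrite /= tev_tmap.
Qed.

Hypothesis two_neq0 : 2%:R != 0 :> K.

Lemma dual_zinbiel_defect xi eta zeta x :
  (dual_prod alpha xi (dual_prod alpha eta zeta)
   - dual_prod alpha (dual_prod alpha xi eta + dual_prod alpha eta xi) zeta) x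
  = tev (tev xi eta) zeta
      (tmap (tmap (lmult mul x) id) id (zbracket mul r)
       - tmap id (lmult mul x \+ rmult mul x) (zbracket mul r))
    - \sum_i (tev xi eta (lmult_defect mul x (a i) s) *+ 2) * zeta (b i).
Proof.
have xil := dual_linear xi; have etal := dual_linear eta; have zetal := dual_linear zeta.
have xixl := linear_comp_mul x xil; have zetaxl := linear_comp_lrmul x zetal.
rewrite (tev_H _ _ xil etal zetal) (tev_zbracket xixl etal zetal).
rewrite (tev_zbracket xil etal zetaxl) add_lfunE opp_lfunE.
(* The [j]-th summand of a dual product evaluated at [y]; nested dual products thus become double
   sums. *)
pose d (f g : A -> K) y j :=
  f (a j) * (g (mul y (b j)) + g (mul (b j) y)) - f (mul y (a j)) * g (b j).
have dE phi psi y : dual_prod alpha phi psi y = \sum_j d phi psi y j.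
  exact: dual_prod_coboundary.
have -> : dual_prod alpha xi (dual_prod alpha eta zeta) x =
    \sum_i \sum_j (xi (a i) * (d eta zeta (mul x (b i)) j + d eta zeta (mul (b i) x) j)
                   - xi (mul x (a i)) * d eta zeta (b i) j).
  rewrite dE; apply: eq_bigr => i _.
  by rewrite [LHS]/d !dE [RHS]sumrB -!mulr_sumr [in RHS]big_split.
have -> : dual_prod alpha (dual_prod alpha xi eta + dual_prod alpha eta xi) zeta x =
    \sum_i \sum_j ((d xi eta (a i) j + d eta xi (a i) j)
                     * (zeta (mul x (b i)) + zeta (mul (b i) x))
                   - (d xi eta (mul x (a i)) j + d eta xi (mul x (a i)) j) * zeta (b i)).
  rewrite dE; apply: eq_bigr => i _.
  rewrite [LHS]/d !add_lfunE !dE [RHS]sumrB -!mulr_suml.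
  by congr (_ * _ - _ * _); exact/esym/big_split.
under [X in _ = _ - X]eq_bigr => i _ do
  rewrite (tev_lmult_defect_skew x (a i) xil etal) mulr_suml.
rewrite -!sumrB; under eq_bigr => i _ do rewrite -sumrB.
under [RHS]eq_bigr => i _ do rewrite -!sumrB.
(* Some summands match only after [i] and [j] are exchanged: the term of the bracket in
   $\xi(xa_i)\eta(a_jb_i)\zeta(b_j)$ cancels against the correction term in
   $\xi(xa_j)\eta(a_ib_j)\zeta(b_i)$. *)
apply: (eq_sum2_swap _ _ two_neq0) => i j; rewrite /d /cprod /lmult /rmult /=.
have := linD xil; have := linD etal; have := linD zetal.
(* [ring] does not identify the operations of [K] and [K^o], so the functionals are
   first turned into plain additive maps to [K]. *)
generalize (xi : A -> K) (eta : A -> K) (zeta : A -> K).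
move=> {xi eta zeta xil etal zetal xixl zetaxl dE d} f g h hD gD fD.
rewrite !mulE !fD !gD !hD.
ring.
Qed.

End Coboundary.

Theorem theorem3p5 (K : fieldType) (charK : 2%N \notin [pchar K])
    (A : vectType K) (mul : A -> A -> A) (zinA : is_zinbiel mul)
    (r a Lam : tens A A) (ra : r = a + Lam) (skew_a : skew_tens a)
    (symm_Lam : symm_tens Lam) :
  is_zinbiel_bialgebra mul (coboundary mul r)
  <->
  (forall x y : A,
     tmap (lmult mul (mul x y)) id a - tmap id (lmult mul (mul x y)) a
     - tmap (lmult mul x \o lmult mul y) id a
     + tmap (lmult mul x) (lmult mul y) a = 0)
  /\
  (forall x : A,
     tmap (tmap (lmult mul x) id) id (zbracket mul r)
     - tmap id (lmult mul x \+ rmult mul x) (zbracket mul r) = 0).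
Proof.
have two_neq0 : 2%:R != 0 :> K by move: charK; rewrite inE.
(* Only [r] is decomposed; [a] and [Lam] stay abstract. *)
have [n [u [v rE]]] := tens_sum_pure r; move: ra; rewrite {}rE => ra.
have coc := dual_cocycle_defect zinA ra skew_a symm_Lam.
have zin := dual_zinbiel_defect zinA ra skew_a symm_Lam two_neq0.
have ev0 (xi eta : dual A) : tev xi eta 0 = 0 by apply: lin0 (tev_linear _ _).
have ev30 (xi eta zeta : dual A) : tev (tev xi eta) zeta 0 = 0.
  exact: lin0 (tev_linear _ _).
split=> [[_ _ [_ dualA] _ dualC]|[lmult0 H0]].
  have lmult0 x y : lmult_defect mul x y a = 0.
    apply: tev_nondeg_dual => xi eta; apply/eqP.
    have /eqP := coc xi eta x y.
    rewrite dualC subrr (lin0 (tev_linear _ _)) eq_sym oppr_eq0 -mulr_natl.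
    by rewrite mulf_eq0 (negPf two_neq0).
  split=> // x; apply: tev3_nondeg_dual => xi eta zeta.
  (* Condition (i), just obtained at the pairs [x], [u i], removes the correction sum and leaves the
     pairing with $H(x)[\![r,r]\!]$. *)
  have := zin xi eta zeta x; rewrite dualA subrr zero_lfunE [X in _ - X]big1 ?subr0 //.
  by move=> i _; rewrite lmult0 ev0 mul0rn mul0r.
split=> //.
- exact: coboundary_linear.
- split; first exact: bilin_dual_prod_coboundary.
  move=> xi eta zeta; apply/eqP; rewrite -subr_eq0; apply/eqP/lfunP => x.
  rewrite zin H0 ev30 zero_lfunE big1 ?subr0 // => i _.
  by rewrite /lmult_defect lmult0 ev0 mul0rn mul0r.
- exact: coboundary_cocycle.
(* The cocycle defect lies in $A^*\otimes A^*$, where evaluations at pairs of vectors of [A] detect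
   zero. *)
- move=> xi eta; apply/eqP; rewrite -subr_eq0; apply/eqP/tev_nondeg_eval => x y.
  by rewrite coc /lmult_defect lmult0 ev0 mul0rn oppr0.
Qed.
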